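(* Let $\operatorname{T}:\mathbb{R}^d\to\mathbb{R}^d$ be an averaged operator and let $\mathbf{x}^\star\in\operatorname{Fix}\operatorname{T}$ (in particular $\operatorname{Fix}\operatorname{T}\ne\emptyset$). Let $\{\mathbf{x}(k)\}_{k\in\mathbb{N}_0}$ be generated by DEGAS (recursion given in the context), where the delay sequence $\{\tau(k)\}_{k\in\mathbb{N}_0}$ and the block sequence $\{i(k)\}_{k\in\mathbb{N}_0}$ are independent, and suppose that $\lim_{k\to+\infty}(k-\tau(k))=+\infty$. Then $$\lim_{k\to+\infty}\ \inf_{t\le k}\ \mathbb{E}\big[\|(\operatorname{Id}-\operatorname{T})(\mathbf{x}(t))\|\big]=0.$$
   Context: $\mathbb{N}=\{1,2,\dots\}$, $\mathbb{N}_0=\mathbb{N}\cup\{0\}$, $[m]=\{1,\dots,m\}$, $\|\cdot\|$ is the Euclidean norm, $\operatorname{Id}$ is the identity and $\operatorname{Fix}\operatorname{T}=\{\mathbf{x}:\operatorname{T}(\mathbf{x})=\mathbf{x}\}$. Vectors $\mathbf{x}\in\mathbb{R}^d$ are split into $m\in\mathbb{N}$ blocks, $\mathbf{x}=(x_1,\dots,x_m)$, $x_i\in\mathbb{R}^{d_i}$, $\sum_i d_i=d$, and $\operatorname{T}(\mathbf{x})=(\operatorname{T}_1(\mathbf{x}),\dots,\operatorname{T}_m(\mathbf{x}))$ is split accordingly. DEGAS: from a deterministic initial iterate $\mathbf{x}(0)\in\mathbb{R}^d$, for each $k\in\mathbb{N}_0$, $$x_j(k+1)=\operatorname{T}_j(\mathbf{x}(k-\tau(k)))\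 \text{ if } j=i(k),\qquad x_j(k+1)=x_j(k)\ \text{ otherwise},$$ where the delay $\tau(k)$ is an integer in $[0,k]$, and the selected blocks $i(k)$ are independent and each uniformly distributed on $[m]$. The expectation is taken over the block selections only (the delay sequence, being independent of the blocks, is treated as fixed). $\operatorname{T}$ is averaged if $\operatorname{T}=(1-\alpha)\operatorname{Id}+\alpha R$ for some $\alpha\in(0,1)$ and some non-expansive operator $R$ (i.e. $\|R(\mathbf{x})-R(\mathbf{y})\|\le\|\mathbf{x}-\mathbf{y}\|$ for all $\mathbf{x},\mathbf{y}$). *)

(* Defs.v *)
From HB Require Import structures.
From mathcomp Require Import all_boot all_order all_algebra finmap.
From mathcomp Require Import all_classical all_reals all_analysis.

Set Implicit Arguments.
Unset Strict Implicit.
Unset Printing Implicit Defensive.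

Import Order.TTheory GRing.Theory Num.Theory.
Import numFieldNormedType.Exports.

Local Open Scope classical_set_scope.
Local Open Scope ring_scope.

(* The canonical norm [`|x|] on matrices is the sup norm, hence this definition. *)
Definition enorm (R : realType) (n : nat) (x : 'cV[R]_n) : R :=
  Num.sqrt (\sum_(i < n) x i 0 ^+ 2).

Definition nonexpansive (R : realType) (n : nat) (S : 'cV[R]_n -> 'cV[R]_n) :=
  forall x y, enorm (S x - S y) <= enorm (x - y).

Definition averaged (R : realType) (n : nat) (T : 'cV[R]_n -> 'cV[R]_n) :=
  exists (alpha : R) (S : 'cV[R]_n -> 'cV[R]_n),
    [/\ 0 < alpha < 1, nonexpansive S &
        forall x, T x = (1 - alpha) *: x + alpha *: S x].

Definition Fix (X : Type) (T : X -> X) : set X := [set x | T x = x].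

(* A finite type [E] carries its discrete sigma-algebra: every subset of [E] is
   measurable. *)
Section finite_random_elements.
Context (d : measure_display) (Omega : measurableType d) (R : realType).
Context (P : probability Omega R) (E : finType).

Definition random_element (X : Omega -> E) :=
  forall A : set E, measurable (X @^-1` A).

Definition uniformly_distributed (X : Omega -> E) :=
  forall e : E, P (X @^-1` [set e]) = (#|E|%:R^-1)%:E.

Definition mutually_independent (I : choiceType) (X : I -> Omega -> E) :=
  forall (K : {fset I}) (A : I -> set E),
    P (\bigcap_(k in [set` K]) X k @^-1` A k) =
    (\prod_(k <- K) P (X k @^-1` A k))%E.

End finite_random_elements.

(* Block [j] of [x] is [submxcol x j : 'cV_(b j)]. The delay satisfies
   [tau k <= k], so that the truncated subtraction is the genuine one. *)
Definition DEGAS (R : realType) (m : nat) (b : 'I_m -> nat) (Omega : Type)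
    (T : 'cV[R]_(\sum_(j < m) b j) -> 'cV[R]_(\sum_(j < m) b j))
    (x0 : 'cV[R]_(\sum_(j < m) b j))
    (tau : nat -> nat) (i : nat -> Omega -> 'I_m)
    (x : nat -> Omega -> 'cV[R]_(\sum_(j < m) b j)) :=
  [/\ forall k, (tau k <= k)%N,
      forall w, x 0%N w = x0 &
      forall k w (j : 'I_m),
        submxcol (x k.+1 w) j =
          if j == i k w then submxcol (T (x (k - tau k)%N w)) j
          else submxcol (x k w) j].

(* Main.v *)
Require Import Defs.
From HB Require Import structures.
From mathcomp Require Import all_boot all_order all_algebra finmap.
From mathcomp Require Import all_classical all_reals all_analysis.
From mathcomp Require Import ring lra.

Set Implicit Arguments.
Unset Strict Implicit.
Unset Printing Implicit Defensive.
Import Order.TTheory GRing.Theory Num.Theory.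
Import numFieldNormedType.Exports.
Local Open Scope classical_set_scope.
Local Open Scope ring_scope.

(** Let [V k] be the expected squared distance from [x k] to [xstar], let [m] be
the number of blocks and [s k = k - tau k]. Writing an averaged operator as
[(1 - a) Id + a S], the identity for the squared norm of a convex combination
gives a constant [c > 0] with
  [|T x - xstar|^2 <= |x - xstar|^2 - c |x - T x|^2]
([averaged_residual]). At step [k] only the block [i k] of the squared distance
changes ([DEGAS_sqnorm_step]); both [x k] and [x (s k)] are determined by the
choices made before [k], so [i k] is uniform and independent of them, and
integrating amounts to averaging over the chosen block
([Rintegral_next_choice]). Summing the blocks yields
  [V (k + 1) <= (1 - 1/m) V k + (1/m) (V (s k) - c g (s k))],
where [g k] is the expected squared residual [E |x k - T (x k)|^2].

The delays may be unbounded, so [V] need not be monotone. Since [s k] tends to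
infinity, however, an eventual bound [B] on [V] is also an eventual bound on
[V (s k)]. If [c g] stayed above some [delta > 0], the recursion would contract
[V] geometrically towards [B - delta], so that [B - delta / 2] would be an
eventual bound as well; iterating drives the nonnegative sequence [V] below [0].
Hence [g] takes arbitrarily small values ([delayed_recursion_residual]). As
[2 eps a - eps^2 <= a^2], so does [E |x k - T (x k)|], and its nonincreasing
running infimum tends to [0] ([running_inf_cvg0]).

There is no measurability difficulty: a function of the first [k] choices takes
finitely many values, and is a finite combination of indicators of cylinders,
whose probabilities are given by independence ([past_cylinders],
[cylinder_next_indep]). *)

(** * A recursion with unbounded delays *)

(** The recursion is an average of [V k] and a delayed value, so [V] never
exceeds [V 0]. Were [g] bounded below by [delta], each eventual upper bound of
[V] could be lowered by [delta / 2], against [V >= 0]. *)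
Lemma delayed_recursion_residual (R : realType) (V g : nat -> R)
    (s : nat -> nat) (mu : R) :
  0 < mu <= 1 -> (forall k, (s k <= k)%N) -> s k @[k --> \oo] --> \oo ->
  (forall k, 0 <= V k) -> (forall k, 0 <= g k) ->
  (forall k, V k.+1 <= (1 - mu) * V k + mu * (V (s k) - g (s k))) ->
  forall delta, 0 < delta -> exists t, g t < delta.
Proof.
move=> /andP[mu0 mu1] s_le s_oo V0 g0 Vrec delta delta0.
apply: contrapT => g_lt; have {g_lt} g_ge t : delta <= g t.
  by rewrite leNgt; apply/negP => gt; apply: g_lt; exists t.
have V_le k : V k <= V 0%N.
  elim/ltn_ind: k => -[//|k] IH; apply: le_trans (Vrec k) _.
  have := IH k (leqnn _); have := IH (s k) (s_le k); have := g0 (s k).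
  by nra.
(* For an eventual bound B, the value B - delta is the fixed point of the
   recursion with V (s k) replaced by B and g (s k) by delta; half of the drop
   delta is reached after finitely many steps. *)
have drop n : exists K, forall k, (K <= k)%N -> V k <= V 0%N - n%:R * (delta / 2).
  elim: n => [|n [K VK]]; first by exists 0%N => k _; rewrite mul0r subr0.
  set B := V 0%N - _ in VK.
  have [K1 _ sK1] : \forall k \near \oo, (K <= s k)%N.
    exact: (s_oo _ (nbhs_infty_ge K)).
  (* Past M, both V k and V (s k) are bounded by B. *)
  pose M := maxn K K1.
  have geo p : V (M + p)%N <= B - delta + (1 - mu) ^+ p * delta.
    elim: p => [|p IHp].
      by rewrite addn0 expr0 mul1r subrK; apply: VK; rewrite leq_maxl.
    rewrite addnS; apply: le_trans (Vrec _) _.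
    have Vs : V (s (M + p)%N) <= B.
      apply: VK; apply: sK1 => /=; apply: leq_trans (leq_maxr K K1) _.
      exact: leq_addr.
    have := g_ge (s (M + p)%N); rewrite exprS; nra.
  have [N _ HN] : \forall p \near \oo, (1 - mu) ^+ p < 1 / 2.
    have /cvgr_lt : (1 - mu) ^+ p @[p --> \oo] --> 0.
      by apply: cvg_expr; rewrite ger0_norm; lra.
    by apply; lra.
  exists (M + N)%N => k leMNk.
  have leMk : (M <= k)%N by apply: leq_trans leMNk; exact: leq_addr.
  have := geo (k - M)%N; rewrite subnKC// => /le_trans; apply.
  have /HN /= h : (N <= k - M)%N by rewrite leq_subRL.
  rewrite -natr1 mulrDl mul1r opprD addrA -/B; nra.
pose n := Num.bound (V 0%N / (delta / 2)).
have [K VK] := drop n.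
have := VK K (leqnn K); apply/negP; rewrite -ltNge.
apply: lt_le_trans (V0 K); rewrite subr_lt0 -ltr_pdivrMr; last by lra.
by apply: archi_boundP; rewrite divr_ge0// divr_ge0// ltW.
Qed.

(** * Squared Euclidean norms and averaged operators *)

Definition sqnorm (R : realType) (n : nat) (v : 'cV[R]_n) : R :=
  \sum_(i < n) v i 0 ^+ 2.

Lemma sqnorm_ge0 (R : realType) (n : nat) (v : 'cV[R]_n) : 0 <= sqnorm v.
Proof. by apply: sumr_ge0 => i _; exact: sqr_ge0. Qed.

Lemma sqr_enorm (R : realType) (n : nat) (v : 'cV[R]_n) :
  enorm v ^+ 2 = sqnorm v.
Proof. by rewrite sqr_sqrtr// sqnorm_ge0. Qed.

(** Matrix products are compatible with block decompositions, which makes this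
form the convenient one for splitting the squared norm into blocks. *)
Lemma sqnorm_dot (R : realType) (n : nat) (v : 'cV[R]_n) :
  sqnorm v = (v^T *m v) 0 0.
Proof. by rewrite mxE; apply: eq_bigr => l _; rewrite mxE expr2. Qed.

Lemma sqnorm_blocks (R : realType) (m : nat) (b : 'I_m -> nat)
    (v : 'cV[R]_(\sum_(j < m) b j)) :
  sqnorm v = \sum_(j < m) sqnorm (submxcol v j).
Proof.
rewrite sqnorm_dot -[v in LHS]submxcolK tr_mxcol mul_mxrow_mxcol summxE.
by apply: eq_bigr => j _; rewrite sqnorm_dot.
Qed.

Lemma sqnorm_convex_comb (R : realType) (n : nat) (a : R) (p q : 'cV[R]_n) :
  sqnorm ((1 - a) *: p + a *: q) =
  (1 - a) * sqnorm p + a * sqnorm q - a * (1 - a) * sqnorm (p - q).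
Proof.
rewrite /sqnorm !mulr_sumr -big_split -sumrB.
by apply: eq_bigr => l _; rewrite !mxE/=; ring.
Qed.

(** For [T = (1 - a) Id + a S], the fixed point is also fixed by [S], and
[x - T x = a (x - S x)]; the convexity identity applied to [x - xstar] and
[S x - xstar] then gives the claim with [c = (1 - a) / a]. *)
Lemma averaged_residual (R : realType) (n : nat) (T : 'cV[R]_n -> 'cV[R]_n) :
  averaged T -> exists2 c : R, 0 < c &
    forall xstar, Fix T xstar -> forall x,
      sqnorm (T x - xstar) <= sqnorm (x - xstar) - c * sqnorm (x - T x).
Proof.
move=> [a [S [/andP[a0 a1] S_ne TE]]].
have an0 : a != 0 by rewrite gt_eqF.
exists ((1 - a) / a); first by rewrite divr_gt0// subr_gt0.
move=> y Ty x.
have Sy : S y = y.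
  apply: (scalerI an0); apply: (addrI ((1 - a) *: y)).
  by rewrite -TE Ty -scalerDl subrK scale1r.
have le_pq : sqnorm (S x - y) <= sqnorm (x - y).
  rewrite -!sqr_enorm -{1}Sy ler_sqr ?nnegrE ?sqrtr_ge0//; exact: S_ne.
have -> : T x - y = (1 - a) *: (x - y) + a *: (S x - y).
  by rewrite TE; apply/matrixP => l k; rewrite !mxE; ring.
have -> : x - T x = a *: ((x - y) - (S x - y)).
  by rewrite TE; apply/matrixP => l k; rewrite !mxE; ring.
have -> v : sqnorm (a *: v) = a ^+ 2 * sqnorm v.
  by rewrite /sqnorm mulr_sumr; apply: eq_bigr => l _; rewrite mxE exprMn.
rewrite sqnorm_convex_comb.
have -> u : (1 - a) / a * (a ^+ 2 * u) = a * (1 - a) * u by field.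
nra.
Qed.

(** * Functions of the past choices *)

(** Measurability with respect to the sigma-algebra of [i 0], ..., [i (k - 1)],
stated pointwise: as each choice ranges over a finite type, this is the same as
being determined by these choices. *)
Definition past (Omega E X : Type) (i : nat -> Omega -> E) (k : nat)
    (f : Omega -> X) :=
  forall w w', (forall l, (l < k)%N -> i l w = i l w') -> f w = f w'.

Definition cylinder (Omega : Type) (E : finType) (i : nat -> Omega -> E)
    (k : nat) (u : {ffun 'I_k -> E}) : set Omega :=
  [set w | forall l : 'I_k, i l w = u l].

Lemma past_leq (Omega E X : Type) (i : nat -> Omega -> E) (k l : nat)
    (f : Omega -> X) : (k <= l)%N -> past i k f -> past i l f.
Proof.
by move=> kl fk w w' ww'; apply: fk => t tk; apply: ww'; exact: leq_trans kl.
Qed.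

(** The cylinders partition [Omega] into finitely many sets, on each of which
[f] is constant. *)
Lemma past_cylinders (R : realType) (Omega : Type) (E : finType)
    (i : nat -> Omega -> E) (k : nat) (f : Omega -> R) :
  past i k f ->
  exists c : {ffun 'I_k -> E} -> R,
    forall w, f w = \sum_u c u * \1_(cylinder i u) w.
Proof.
move=> fk.
(* A sequence of choices that no sample point realizes has an empty cylinder,
   on which f has no value; hence the default 0. *)
pose c (u : {ffun 'I_k -> E}) := if pselect (exists w, cylinder i u w) is left h
            then f (projT1 (cid h)) else 0.
exists c => w; pose u0 := [ffun l : 'I_k => i l w].
have wu0 : cylinder i u0 w by move=> l; rewrite ffunE.
rewrite (bigD1 u0)//= big1 => [|u /eqP uNu0]; last first.
  rewrite indicE memNset ?mulr0// => wu; apply: uNu0.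
  by apply/ffunP => l; rewrite ffunE -wu.
rewrite addr0 indicE mem_set// mulr1 /c.
case: pselect => [h|]; last by case; exists w.
apply: fk => l lk; have := projT2 (cid h) (Ordinal lk).
by rewrite ffunE.
Qed.

(** The form in which mutual independence applies: an intersection, over a
finite set of naturals, of events on single choices. Outside [l < k] the event
is the sure one. *)
Lemma cylinder_bigcap (Omega : Type) (E : finType) (i : nat -> Omega -> E)
    (k : nat) (u : {ffun 'I_k -> E}) :
  cylinder i u =
  \bigcap_(l in [set` [fset t in iota 0 k]%fset])
     (i l @^-1` [set e | forall lk : (l < k)%N, e = u (Ordinal lk)]).
Proof.
apply/seteqP; split=> w /= h.
  by move=> l _ lk; exact: (h (Ordinal lk)).
move=> [l lk]; apply: (h l) => /=.
by rewrite !inE mem_iota.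
Qed.

Section expectation_of_the_past.
Context (R : realType) (d : measure_display) (Omega : measurableType d).
Context (P : probability Omega R) (E : finType) (i : nat -> Omega -> E).
Hypothesis i_random : forall k, random_element (i k).
Hypothesis i_uniform : forall k, uniformly_distributed P (i k).
Hypothesis i_indep : mutually_independent P i.

Lemma measurable_cylinder k (u : {ffun 'I_k -> E}) : measurable (cylinder i u).
Proof.
rewrite cylinder_bigcap; apply: fin_bigcap_measurable => // l _.
exact: i_random.
Qed.

(** Mutual independence is used for the choices before [k], and for these choices
together with [i k]; the quotient of the two product formulas is [P (i k = j)]. *)
Lemma cylinder_next_indep k (u : {ffun 'I_k -> E}) (j : E) :
  P (cylinder i u `&` i k @^-1` [set j]) =
  (P (cylinder i u) * (#|E|%:R^-1)%:E)%E.
Proof.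
pose A l := [set e | forall lk : (l < k)%N, e = u (Ordinal lk)].
pose B l := if l == k then [set j] else A l.
pose K := [fset t in iota 0 k]%fset.
have kK : k \notin K by rewrite !inE mem_iota add0n ltnn andbF.
have BA l : l \in K -> B l = A l.
  by move=> lK; rewrite /B; case: eqP => // lk; rewrite -lk lK in kK.
have -> : cylinder i u `&` i k @^-1` [set j] =
    \bigcap_(l in [set` (k |` K)%fset]) i l @^-1` B l.
  rewrite cylinder_bigcap -/K set_fsetU1 bigcap_setU1 setIC {1}/B eqxx.
  congr (_ `&` _); apply: eq_bigcapr => l lK; by rewrite BA.
rewrite i_indep big_fsetU1//= /B eqxx i_uniform muleC.
rewrite cylinder_bigcap i_indep; congr (_ * _)%E.
rewrite [LHS]big_seq [RHS]big_seq.
by apply: eq_bigr => l lK; have := BA l lK; rewrite /B => ->.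
Qed.

Lemma simple_integrable (I : finType) (c : I -> R) (A : I -> set Omega) :
  (forall u, measurable (A u)) ->
  P.-integrable setT (EFin \o (fun w => \sum_u c u * \1_(A u) w)).
Proof.
move=> mA; rewrite (_ : EFin \o _ =
    fun w => (\sum_u (c u)%:E * (\1_(A u) w)%:E)%E); last first.
  by apply/funext => w /=; rewrite sumEFin.
apply: integrable_sum => // u _; apply: integrableZl => //.
exact: integrable_indic.
Qed.

Lemma simple_Rintegral (I : finType) (c : I -> R) (A : I -> set Omega) :
  (forall u, measurable (A u)) ->
  \int[P]_w (\sum_u c u * \1_(A u) w) = \sum_u c u * fine (P (A u)).
Proof.
move=> mA; rewrite /Rintegral.
under eq_integral do rewrite -sumEFin.
have intZ u : P.-integrable setT (fun w => (c u * \1_(A u) w)%:E).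
  under eq_fun do rewrite EFinM.
  by apply: integrableZl => //; exact: integrable_indic.
rewrite integral_sum//=.
rewrite (_ : (\sum_u _)%E = (\sum_u c u * fine (P (A u)))%:E)//.
rewrite -sumEFin; apply: eq_bigr => u _.
under eq_integral do rewrite EFinM.
rewrite integralZl//; last exact: integrable_indic.
by rewrite integral_indic// setIT EFinM fineK// fin_num_measure.
Qed.

Lemma past_integrable k (f : Omega -> R) :
  past i k f -> P.-integrable setT (EFin \o f).
Proof.
move=> /past_cylinders[c /funext ->].
by apply: simple_integrable => u; exact: measurable_cylinder.
Qed.

(** Conditionally on the past, the choice [i k] is uniform. Both sides are
integrals of simple functions, indexed by a value of [i k] and a cylinder, and
they agree term by term. *)
Lemma Rintegral_next_choice k (F : E -> Omega -> R) :
  (forall j, past i k (F j)) ->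
  \int[P]_w F (i k w) w = \int[P]_w (#|E|%:R^-1 * \sum_j F j w).
Proof.
move=> F_past; have /choice[c FE] j := past_cylinders (F_past j).
pose I := (E * {ffun 'I_k -> E})%type.
have -> : (fun w => F (i k w) w) = (fun w => \sum_(ju : I)
    c ju.1 ju.2 * \1_(cylinder i ju.2 `&` i k @^-1` [set ju.1]) w).
  apply/funext => w.
  rewrite -(pair_bigA _ (fun j u =>
    c j u * \1_(cylinder i u `&` i k @^-1` [set j]) w))/=.
  rewrite (bigD1 (i k w))//= [X in _ + X]big1 ?addr0 => [|j jw]; last first.
    apply: big1 => u _; rewrite indicE memNset ?mulr0//= => -[_ /= wj].
    by rewrite wj eqxx in jw.
  rewrite FE; apply: eq_bigr => u _; congr (_ * _).
  by rewrite !indicE in_setI [X in _ && X]mem_set ?andbT.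
have -> : (fun w => #|E|%:R^-1 * \sum_j F j w) = (fun w => \sum_(ju : I)
    (#|E|%:R^-1 * c ju.1 ju.2) * \1_(cylinder i ju.2) w).
  apply/funext => w.
  rewrite -(pair_bigA _ (fun j u => #|E|%:R^-1 * c j u * \1_(cylinder i u) w))/=.
  rewrite mulr_sumr; apply: eq_bigr => j _; rewrite FE mulr_sumr.
  by apply: eq_bigr => u _; rewrite mulrA.
have mcyl (ju : I) : measurable (cylinder i ju.2) by exact: measurable_cylinder.
rewrite !simple_Rintegral => [//||ju]; last first.
- by apply: measurableI => //; exact: i_random.
- by [].
apply: eq_bigr => -[j u] _ /=.
rewrite cylinder_next_indep fineM ?fin_num_measure//=; last first.
  exact: measurable_cylinder.
by ring.
Qed.

End expectation_of_the_past.

(** * The iterates *)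

Section trajectory.
Context (R : realType) (m : nat) (b : 'I_m -> nat) (Omega : Type).
Context (T : 'cV[R]_(\sum_(j < m) b j) -> 'cV[R]_(\sum_(j < m) b j)).
Context (x0 : 'cV[R]_(\sum_(j < m) b j)) (tau : nat -> nat).
Context (i : nat -> Omega -> 'I_m).
Context (x : nat -> Omega -> 'cV[R]_(\sum_(j < m) b j)).
Hypothesis hx : DEGAS T x0 tau i x.

Lemma DEGAS_past k : past i k (x k).
Proof.
have [tau_le x_0 x_rec] := hx.
elim/ltn_ind: k => -[_ w w' _|k IH w w' ww']; first by rewrite !x_0.
have past_eq l : (l <= k)%N -> x l w = x l w'.
  by move=> lk; apply: IH => // t tl; apply: ww'; rewrite ltnS ltnW// (leq_trans tl).
apply/mxcolP => j; rewrite !x_rec ww'//.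
by rewrite !past_eq// leq_subr.
Qed.

(** Stated with the chosen block as an argument of the correction term, so that
[i k w] can be averaged out while [x k] and the delayed iterate are kept. *)
Lemma DEGAS_sqnorm_step (y : 'cV[R]_(\sum_(j < m) b j)) k w :
  sqnorm (x k.+1 w - y) = sqnorm (x k w - y) +
    (sqnorm (submxcol (T (x (k - tau k)%N w) - y) (i k w)) -
     sqnorm (submxcol (x k w - y) (i k w))).
Proof.
have [_ _ x_rec] := hx.
rewrite [LHS]sqnorm_blocks [in RHS]sqnorm_blocks (bigD1 (i k w))//=.
rewrite [in RHS](bigD1 (i k w))//= submxcolB x_rec eqxx -submxcolB.
rewrite [in LHS](eq_bigr (fun j => sqnorm (submxcol (x k w - y) j))) => [|j jw].
  by ring.
by rewrite submxcolB x_rec (negbTE jw) -submxcolB.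
Qed.

End trajectory.

(** * Convergence of the running infimum *)

Lemma running_inf_cvg0 (R : realType) (u : nat -> \bar R) :
  (forall t, 0%E <= u t)%E ->
  (forall eps : R, 0 < eps -> exists t, (u t < eps%:E)%E) ->
  ereal_inf [set u t | t in [set t : nat | (t <= k)%N]] @[k --> \oo] --> 0%E.
Proof.
move=> u0 u_small.
pose h k := ereal_inf [set u t | t in [set t : nat | (t <= k)%N]].
have h_le k t : (t <= k)%N -> (h k <= u t)%E.
  by move=> tk; apply: ereal_inf_lbound; exists t.
have h0 k : (0 <= h k)%E by apply/ereal_infP => _ [t _ <-].
have h_dec : nonincreasing_seq h.
  move=> k l kl; apply/ereal_infP => _ [t /= tk <-].
  by apply: h_le; exact: leq_trans kl.
have <- : ereal_inf (range h) = 0%E; last exact: ereal_nonincreasing_cvgn.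
apply/eqP; rewrite eq_le; apply/andP; split; last first.
  by apply/ereal_infP => _ [t _ <-].
apply/lee_addgt0Pr => eps eps0; rewrite add0e.
have [t /ltW] := u_small _ eps0; apply: le_trans.
by apply: le_trans (h_le t t _) => //; apply: ereal_inf_lbound; exists t.
Qed.


Theorem theorem4 (R : realType) (m : nat) (hm : (0 < m)%N) (b : 'I_m -> nat)
    (T : 'cV[R]_(\sum_(j < m) b j) -> 'cV[R]_(\sum_(j < m) b j))
    (hT : averaged T)
    (xstar : 'cV[R]_(\sum_(j < m) b j)) (hxstar : Fix T xstar)
    (d : measure_display) (Omega : measurableType d) (P : probability Omega R)
    (i : nat -> Omega -> 'I_m)
    (i_random : forall k, random_element (i k))
    (i_uniform : forall k, uniformly_distributed P (i k))
    (i_indep : mutually_independent P i)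
    (tau : nat -> nat)
    (x0 : 'cV[R]_(\sum_(j < m) b j))
    (x : nat -> Omega -> 'cV[R]_(\sum_(j < m) b j))
    (hx : DEGAS T x0 tau i x)
    (htau : (k - tau k)%N @[k --> \oo] --> \oo) :
  ereal_inf [set ('E_P[fun w => enorm (x t w - T (x t w))])%E |
              t in [set t : nat | (t <= k)%N]] @[k --> \oo] --> 0%E.
Proof.
have [c c0 T_res] := averaged_residual hT.
have integ k (F : 'cV[R]_(\sum_(j < m) b j) -> R) :
    P.-integrable setT (EFin \o (fun w => F (x k w))).
  apply: (@past_integrable _ _ _ P _ i i_random k) => w w' ww'.
  by rewrite (DEGAS_past hx ww').
pose V k := \int[P]_w sqnorm (x k w - xstar).
pose g k := \int[P]_w sqnorm (x k w - T (x k w)).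
have m_gt0 : 0 < m%:R :> R by rewrite ltr0n.
have V_rec k : V k.+1 <= (1 - m%:R^-1) * V k +
    m%:R^-1 * (V (k - tau k)%N - c * g (k - tau k)%N).
  have s_le : (k - tau k <= k)%N by exact: leq_subr.
  set s := (k - tau k)%N in s_le *.
  pose F j w := sqnorm (x k w - xstar) +
    (sqnorm (submxcol (T (x s w) - xstar) j) -
     sqnorm (submxcol (x k w - xstar) j)).
  have F_past j : past i k (F j).
    move=> w w' ww'; rewrite /F (DEGAS_past hx ww').
    by rewrite (past_leq s_le (DEGAS_past hx (k := s)) ww').
  have -> : V k.+1 = \int[P]_w F (i k w) w.
    by apply: eq_Rintegral => w _; rewrite (DEGAS_sqnorm_step hx).
  rewrite (Rintegral_next_choice i_random i_uniform i_indep F_past) card_ord.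
  pose G w := (1 - m%:R^-1) * sqnorm (x k w - xstar) +
    m%:R^-1 * (sqnorm (x s w - xstar) - c * sqnorm (x s w - T (x s w))).
  have int1 := integ k (fun v => (1 - m%:R^-1) * sqnorm (v - xstar)).
  have int2 := integ s (fun v =>
    m%:R^-1 * (sqnorm (v - xstar) - c * sqnorm (v - T v))).
  have -> : (1 - m%:R^-1) * V k + m%:R^-1 * (V s - c * g s) = \int[P]_w G w.
    rewrite RintegralD// !RintegralZl//.
    - by rewrite RintegralB// ?RintegralZl//;
        [exact: (integ s (fun v => sqnorm (v - T v)))
        |exact: (integ s (fun v => sqnorm (v - xstar)))
        |exact: (integ s (fun v => c * sqnorm (v - T v)))].
    - exact: (integ s (fun v => sqnorm (v - xstar) - c * sqnorm (v - T v))).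
    - exact: (integ k (fun v => sqnorm (v - xstar))).
  have mean_F w : m%:R^-1 * \sum_j F j w =
      (1 - m%:R^-1) * sqnorm (x k w - xstar) +
      m%:R^-1 * sqnorm (T (x s w) - xstar).
    rewrite big_split sumrB -!sqnorm_blocks sumr_const card_ord /=.
    by rewrite -mulr_natl; field; rewrite gt_eqF.
  apply: le_Rintegral => //.
  - apply: (@past_integrable _ _ _ P _ i i_random k) => w w' ww'.
    by congr (_ * _); apply: eq_bigr => j _; rewrite (F_past j _ _ ww').
  - apply: (@past_integrable _ _ _ P _ i i_random k) => w w' ww'.
    rewrite /G (DEGAS_past hx ww').
    by rewrite (past_leq s_le (DEGAS_past hx (k := s)) ww').
  - move=> w _; rewrite mean_F lerD2l; apply: ler_wpM2l; last exact: T_res.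
    by rewrite invr_ge0 ltW.
have V0 k : 0 <= V k by apply: Rintegral_ge0 => w _; exact: sqnorm_ge0.
have g0 k : 0 <= g k by apply: Rintegral_ge0 => w _; exact: sqnorm_ge0.
apply: running_inf_cvg0 => [t|eps eps0].
  by apply: expectation_ge0 => w; exact: sqrtr_ge0.
(* The recursion has the residual c g, hence the threshold c eps^2. *)
have [t gt] : exists t, c * g t < c * eps ^+ 2.
  apply: (delayed_recursion_residual _ _ htau V0 _ V_rec).
  - by rewrite invr_gt0 m_gt0 invf_le1// ler1n.
  - by move=> k; exact: leq_subr.
  - by move=> k; rewrite mulr_ge0// ltW.
  - by rewrite mulr_gt0// exprn_gt0.
exists t.
have int_e := integ t (fun v => enorm (v - T v)).
have -> : 'E_P[fun w => enorm (x t w - T (x t w))]%E =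
    (\int[P]_w enorm (x t w - T (x t w)))%:E.
  by rewrite unlock fineK//; exact: integrable_fin_num.
rewrite lte_fin ltNge; apply/negP => e_ge.
have := gt; rewrite ltr_pM2l//; apply/negP; rewrite -leNgt.
(* A linear minorant of the square at eps replaces Jensen's inequality. *)
have : \int[P]_w (2 * eps * enorm (x t w - T (x t w)) - eps ^+ 2) <= g t.
  apply: le_Rintegral => //.
  - exact: (integ t (fun v => 2 * eps * enorm (v - T v) - eps ^+ 2)).
  - exact: (integ t (fun v => sqnorm (v - T v))).
  - move=> w _; rewrite -sqr_enorm.
    by have := sqr_ge0 (enorm (x t w - T (x t w)) - eps); lra.
rewrite RintegralB//; last first.
- exact: (integ t (fun v => eps ^+ 2)).
- exact: (integ t (fun v => 2 * eps * enorm (v - T v))).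
rewrite RintegralZl// Rintegral_cst// [X in fine X]probability_setT/= mulr1.
nra.
Qed.
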